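(* There exists a convex body of revolution $K\subset\mathbb{R}^4$ such that the maximal section function $M_K$ is constant on $\mathbb{S}^3$ and $K$ is not a Euclidean ball.
   Context: A convex body $K\subset\mathbb{R}^d$ is a compact convex subset of $\mathbb{R}^d$ with non-empty interior; it is assumed that $0\in K$. A body of revolution is a body invariant under all rotations about some fixed line (its axis). For $u\in\mathbb{S}^{d-1}$, $u^\perp$ is the hyperplane through the origin orthogonal to $u$. The maximal section function is $M_K(u)=\max_{t\in\mathbb{R}}\mathrm{vol}_{d-1}(K\cap(u^\perp+tu))$, $u\in\mathbb{S}^{d-1}$. Here $d=4$. *)

(* Defs.v *)
From HB Require Import structures.
From mathcomp Require Import all_boot all_order all_algebra.
From mathcomp Require Import all_classical all_reals all_analysis.
From mathcomp Require Import ring.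

Set Implicit Arguments.
Unset Strict Implicit.
Unset Printing Implicit Defensive.

Import Order.TTheory GRing.Theory Num.Theory.
Import numFieldNormedType.Exports.

Local Open Scope classical_set_scope.
Local Open Scope ring_scope.

Definition dot (R : realType) n (x y : 'rV[R]_n) : R := (x *m y^T) 0 0.

(* The norm `|x| that the library puts on 'rV[R]_n is the sup norm. *)
Definition enorm (R : realType) n (x : 'rV[R]_n) : R := Num.sqrt (dot x x).

Definition sphere (R : realType) n : set 'rV[R]_n := [set u | enorm u = 1].

Definition euclidean_ball (R : realType) n (K : set 'rV[R]_n) : Prop :=
  exists p r, 0 < r /\ K = [set x | enorm (x - p) <= r].

(* Includes the standing assumption that the origin lies in the body. *)
Definition convex_body (R : realType) n (K : set 'rV[R]_n) : Prop :=
  [/\ compact K, convex_set (K : set (convex_lmodType 'rV[R]_n)),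
      K° !=set0 & K 0].

(* The linear parts of the rotations about a line of direction v: the elements
   of SO(n) that fix v (row vectors are multiplied on the right). *)
Definition rotation_fixing (R : realType) n (v : 'rV[R]_n) : set 'M[R]_n :=
  [set Q | [/\ Q *m Q^T = 1%:M, \det Q = 1 & v *m Q = v]].

(* The axis is the line through p of direction v; it may miss the origin. *)
Definition body_of_revolution (R : realType) n (K : set 'rV[R]_n) : Prop :=
  exists p v, v != 0 /\
    forall Q, rotation_fixing v Q -> [set p + (x - p) *m Q | x in K] = K.

Definition hyperplane (R : realType) n (u : 'rV[R]_n) (t : R) :
    set 'rV[R]_n :=
  [set x + t *: u | x in [set x | dot x u = 0]].

Definition lebesgue3 (R : realType) : set (R * R * R) -> \bar R :=
  ((@lebesgue_measure R \x @lebesgue_measure R) \x @lebesgue_measure R)%E.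

Definition is_orthonormal_frame (R : realType) (u : 'rV[R]_4)
    (B : 'M[R]_(3, 4)) : Prop :=
  B *m B^T = 1%:M /\ B *m u^T = 0.

(* A chosen matrix whose rows form an orthonormal basis of u^perp; it exists
   for every unit vector u by orthonormal_frameP below. *)
Definition orthonormal_frame (R : realType) (u : 'rV[R]_4) : 'M[R]_(3, 4) :=
  get (is_orthonormal_frame u).

Definition hyperplane_param (R : realType) (u : 'rV[R]_4) (t : R)
    (y : R * R * R) : 'rV[R]_4 :=
  let B := orthonormal_frame u in
  y.1.1 *: row 0 B + y.1.2 *: row 1 B + y.2 *: row 2 B + t *: u.

(* vol_3 on the hyperplane u^perp + t u, for a unit vector u: the parametrisation
   is an isometry of R^3 onto it, and rotation invariance of the Lebesgue measure
   makes the value independent of the chosen basis of u^perp. *)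
Definition hyperplane_volume (R : realType) (u : 'rV[R]_4) (t : R)
    (A : set 'rV[R]_4) : \bar R :=
  lebesgue3 (hyperplane_param u t @^-1` A).

Definition section_volume (R : realType) (K : set 'rV[R]_4) (u : 'rV[R]_4)
    (t : R) : \bar R :=
  hyperplane_volume u t (K `&` hyperplane u t).

(* M_K(u) = m: m is an attained maximum of the section volumes over t, not just
   a supremum; such an m is unique. *)
Definition maximal_section (R : realType) (K : set 'rV[R]_4) (u : 'rV[R]_4)
    (m : \bar R) : Prop :=
  range (section_volume K u) m /\ ubound (range (section_volume K u)) m.

Lemma orthonormal_frameP (R : realType) (u : 'rV[R]_4) :
  sphere u -> is_orthonormal_frame u (orthonormal_frame u).
Proof.
move=> /= u1; apply: getPex.
have {}u1 : dot u u = 1.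
  have := congr1 (fun x => x ^+ 2) u1; rewrite expr1n /enorm sqr_sqrtr //.
  by rewrite /dot mxE sumr_ge0 // => i _; rewrite mxE -expr2 sqr_ge0.
(* the rows are the quaternions iu, ju, ku *)
pose a := u 0 0; pose b := u 0 1; pose c := u 0 2; pose d := u 0 3.
have {}u1 : a * a + b * b + c * c + d * d = 1.
  rewrite -u1 /dot mxE !big_ord_recr big_ord0 /= !mxE add0r.
  by congr (_ + _ + _ + _); rewrite /a /b /c /d; congr (u 0 _ * u 0 _);
    apply/val_inj.
pose s : seq (seq R) :=
  [:: [:: - b; a; - d; c]; [:: - c; d; a; - b]; [:: - d; - c; b; a]].
exists (\matrix_(i, j) nth 0 (nth [::] s i) j); split.
  apply/matrixP => i j; rewrite !mxE !big_ord_recr big_ord0 /= !mxE /=.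
  case: i => [[|[|[|//]]] ?]; case: j => [[|[|[|//]]] ?];
    rewrite /= ?mulr1n ?mulr0n -?u1; ring.
apply/matrixP => i j; rewrite !mxE !big_ord_recr big_ord0 /= !mxE /=.
rewrite ord1.
rewrite [u 0 (widen_ord _ (widen_ord _ (widen_ord _ _)))](_ : _ = a); last first.
  by congr (u 0 _); apply/val_inj.
rewrite [u 0 (widen_ord _ (widen_ord _ _))](_ : _ = b); last first.
  by congr (u 0 _); apply/val_inj.
rewrite [u 0 (widen_ord _ _)](_ : _ = c); last by congr (u 0 _); apply/val_inj.
rewrite [u 0 ord_max](_ : _ = d); last by congr (u 0 _); apply/val_inj.
case: i => [[|[|[|//]]] ?] /=; ring.
Qed.

(* Main.v *)
Require Import Defs.
From HB Require Import structures.
From mathcomp Require Import all_boot all_order all_algebra.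
From mathcomp Require Import all_classical all_reals all_analysis.
From mathcomp Require Import measurable_realfun ring lra.

(** Why such a body exists.

    Write a point of four-dimensional space as (w, x') with w its coordinate
    along the axis.  The body is the sheared unit ball
      K = { (w, x') : (w - |x'|^2 / 2)^2 + |x'|^2 <= 1 },
    the image of the unit ball under (w, x') |-> (w + |x'|^2 / 2, x'): every
    chord parallel to the axis is translated along itself by an amount that
    depends on its distance to the axis only.  So K is a body of revolution, and
    it is not a ball since its chords do not have their midpoints in one
    hyperplane (sheared_ball_not_euclidean).

    Consider a section of K orthogonal to the unit vector u, at height t.  Up to
    a rotation it depends only on a = u_0 and b = sqrt (1 - a^2).  Slice the
    section by the value tau = |x'|^2.  The section lives in dimension three and
    contains, besides a direction z along which w varies, a plane of directions
    that enter only through their squared norm; Lebesgue measure of a plane,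
    pushed forward by the squared norm, is a multiple of Lebesgue measure on the
    half-line (lebesgue2_radial).  This is where dimension four is special: tau
    itself becomes a coordinate with respect to which volume is uniform.
    Therefore the volume of the section is a constant times the integral over
    tau of the length of
      { z : |a z - b t| <= sqrt tau, |b z + a t - tau / 2| <= sqrt (1 - tau) },
    an intersection of two intervals whose lengths do not depend on t or on the
    shear (section_volume_slices).  That length is at most the smaller of the
    two, which is the value for the central section of the unit ball, where the
    intervals are concentric (slice_le).  So no section of K is larger than a
    central section of the unit ball.

    Equality holds if for every tau one interval contains the other.  The two
    lengths agree at tau = a^2, and there the midpoints agree for t = a^3 / 2.
    For other tau the shear displaces the interval of the coordinate w by
    |tau - a^2| / 2, but its half length sqrt (1 - tau) differs from b, the value
    at a^2, by at least as much, because the square root of 1 - tau has slope at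
    least 1/2 in absolute value (norm_half_sqrB_le).  Hence the
    intervals are nested (slice_eq) and the maximum is attained and equals the
    volume of the three-dimensional unit ball, whatever u is.  The same slope
    estimate makes K convex (sheared_profile_convex). *)

Import Order.TTheory GRing.Theory Num.Theory.
Import numFieldNormedType.Exports.
Set Implicit Arguments.
Unset Strict Implicit.
Unset Printing Implicit Defensive.
Local Open Scope classical_set_scope.
Local Open Scope ring_scope.

(** * Product measures and measure-preserving maps *)

Lemma lebesgue_measure_segment_lty (R : realType) (r : R) :
  (@lebesgue_measure R (`[- r, r]%classic)%R < +oo)%E.
Proof.
by rewrite lebesgue_measure_itv /= lte_fin; case: ifP; rewrite -?EFinB ltry.
Qed.

(** Lebesgue measure of the plane carries its own name so that sigma-finiteness,
    which exchanging the order of integration in space requires, can be attached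
    to it. *)
Definition lebesgue2 (R : realType) :
    set (measurableTypeR R * measurableTypeR R) -> \bar R :=
  (@lebesgue_measure R \x @lebesgue_measure R)%E.

Lemma lebesgue2_square_lty (R : realType) (r : R) :
  (@lebesgue2 R (`[- r, r]%classic `*` `[- r, r]%classic)%R < +oo)%E.
Proof.
have mI : measurable (`[- r, r]%classic : set (measurableTypeR R)).
  exact: measurable_itv.
rewrite [ltLHS](product_measure1E lebesgue_measure lebesgue_measure mI mI).
have h := lebesgue_measure_segment_lty r.
by apply: lte_mul_pinfty => //; rewrite ge0_fin_numE.
Qed.

Lemma lebesgue2_sigma_finite (R : realType) : sigma_finite setT (@lebesgue2 R).
Proof.
exists (fun n => `[- n%:R, n%:R]%classic `*` `[- n%:R, n%:R]%classic).
  apply/seteqP; split => // -[x y] _.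
  exists (Num.truncn (Num.max `|x| `|y|)).+1 => //.
  have /ltW := truncnS_gt (Num.max `|x| `|y|).
  by rewrite ge_max => /andP[hx hy]; split; rewrite /= in_itv/= -ler_norml.
move=> n; split; last exact: lebesgue2_square_lty.
by apply: measurableX; exact: measurable_itv.
Qed.

HB.instance Definition _ (R : realType) := Measure.on (@lebesgue2 R).
HB.instance Definition _ (R : realType) :=
  Measure_isSigmaFinite.Build _ _ _ (@lebesgue2 R) (@lebesgue2_sigma_finite R).

Lemma product_measure_ysection d1 d2 (T1 : measurableType d1)
    (T2 : measurableType d2) (R : realType)
    (m1 : {sigma_finite_measure set T1 -> \bar R})
    (m2 : {sigma_finite_measure set T2 -> \bar R}) A : measurable A ->
  ((m1 \x m2) A = \int[m2]_y m1 (ysection A y))%E.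
Proof.
move=> mA; rewrite -[RHS]/((m1 \x^ m2) A)%E.
by apply: product_measure_unique => // B C mB mC; rewrite /= product_measure2E.
Qed.

Lemma measurable_set_ler d (T : measurableType d) (R : realType)
    (f g : T -> R) :
  measurable_fun setT f -> measurable_fun setT g ->
  measurable [set x | f x <= g x].
Proof.
move=> mf mg; have /(_ measurableT [set true]) := measurable_fun_ler mf mg.
by rewrite setTI; apply.
Qed.

Definition measure_preserving d (T : measurableType d) (R : realType)
    (mu : set T -> \bar R) (f : T -> T) :=
  measurable_fun setT f /\
  forall A, measurable A -> mu (f @^-1` A) = mu A.

Lemma measure_preserving_comp d (T : measurableType d) (R : realType)
    (mu : set T -> \bar R) (f g : T -> T) :
  measure_preserving mu f -> measure_preserving mu g ->
  measure_preserving mu (g \o f).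
Proof.
move=> [mf pf] [mg pg]; split; first exact: measurableT_comp.
move=> A mA; rewrite comp_preimage pf ?pg//.
by rewrite -[X in measurable X]setTI; exact: mg.
Qed.

Section fibers.
Context d1 d2 (T1 : measurableType d1) (T2 : measurableType d2) (R : realType).

(** A map that moves points only within the fibres over the first factor, and
    preserves the measure of each fibre, preserves the product measure: no
    Jacobian is involved. *)
Lemma measure_preserving_fiber2 (m1 : {measure set T1 -> \bar R})
    (m2 : {sigma_finite_measure set T2 -> \bar R}) (phi : T1 -> T2 -> T2) :
  measurable_fun setT (fun p => phi p.1 p.2) ->
  (forall x, measure_preserving m2 (phi x)) ->
  measure_preserving (m1 \x m2)%E (fun p => (p.1, phi p.1 p.2)).
Proof.
move=> mphi pphi; split; first exact: measurable_fun_pair.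
move=> A mA; apply: eq_integral => x _ /=.
rewrite -(proj2 (pphi x) (xsection A x)); last exact: measurable_xsection.
by congr (m2 _); apply/seteqP; split=> y; rewrite /= !/(xsection _ _) /= !inE.
Qed.

Lemma measure_preserving_fiber1 (m1 : {sigma_finite_measure set T1 -> \bar R})
    (m2 : {sigma_finite_measure set T2 -> \bar R}) (phi : T2 -> T1 -> T1) :
  measurable_fun setT (fun p => phi p.2 p.1) ->
  (forall y, measure_preserving m1 (phi y)) ->
  measure_preserving (m1 \x m2)%E (fun p => (phi p.2 p.1, p.2)).
Proof.
move=> mphi pphi.
have mf : measurable_fun setT (fun p : T1 * T2 => (phi p.2 p.1, p.2)).
  exact: measurable_fun_pair.
split=> // A mA; rewrite !product_measure_ysection//; last first.
  by rewrite -[X in measurable X]setTI; exact: mf.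
apply: eq_integral => y _ /=.
rewrite -(proj2 (pphi y) (ysection A y)); last exact: measurable_ysection.
by congr (m1 _); apply/seteqP; split=> x; rewrite /= !/(ysection _ _) /= !inE.
Qed.

End fibers.

(** * Translations, dilations and discs *)

Section lebesgue_invariance.
Variable R : realType.
Local Notation L := (measurableTypeR R).
Local Notation lam := (@lebesgue_measure R).
Local Notation lam2 := (@lebesgue2 R).

Lemma lebesgue_measure_shift (a : R) :
  measure_preserving lam (fun x : L => x + a : L).
Proof.
have ma : measurable_fun setT (fun x : L => x + a : L).
  by apply: measurable_funD => //; exact: measurable_cst.
split=> // A mA; apply/esym.
pose mu := pushforward lam (fun x : L => x + a : L).
apply: (lebesgue_measure_unique (mu := mu)) => // _ [[b c]] _ <-.
rewrite /mu /= /pushforward.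
rewrite (_ : _ @^-1` _ = `]b - a, c - a]%classic); last first.
  by apply/seteqP; split => x /=; rewrite !in_itv/= ltrBlDr lerBrDr.
by rewrite !lebesgue_measure_itv /= !lte_fin ltrD2r -!EFinB opprB addrA subrK.
Qed.

Lemma lebesgue_measure_scale (a : R) (A : set L) : 0 < a -> measurable A ->
  lam ((fun x : L => a * x : L) @^-1` A) = (a^-1%:E * lam A)%E.
Proof.
move=> a0 mA.
have ma : measurable_fun setT (fun x : L => a * x : L).
  by apply: measurable_funM => //; exact: measurable_cst.
pose nu := pushforward (mscale (NngNum (ltW a0)) lam) (fun x : L => a * x : L).
have -> : lam A = nu A.
  apply: (lebesgue_measure_unique (mu := nu)) => // _ [[b c]] _ <-.
  rewrite /nu /= /pushforward /mscale /=.
  rewrite (_ : _ @^-1` _ = `]b / a, c / a]%classic); last first.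
    apply/seteqP; split => x /=;
    by rewrite !in_itv/= ltr_pdivrMr// ler_pdivlMr// mulrC.
  rewrite !lebesgue_measure_itv /= !lte_fin ltr_pM2r ?invr_gt0//.
  case: ifPn => _; last by rewrite mule0.
  by rewrite -EFinB -EFinM -mulrBl mulrCA divff ?mulr1// gt_eqF.
by rewrite /nu /pushforward /mscale /= muleA -EFinM mulVf ?mul1e// gt_eqF.
Qed.

Lemma lebesgue2_shift (a : R * R) :
  measure_preserving lam2 (fun p : L * L => (p.1 + a.1, p.2 + a.2) : L * L).
Proof.
have -> : (fun p : L * L => (p.1 + a.1, p.2 + a.2) : L * L) =
  (fun p : L * L => (p.1 + a.1, p.2) : L * L) \o
  (fun p : L * L => (p.1, p.2 + a.2) : L * L) by [].
apply: measure_preserving_comp.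
  apply: (@measure_preserving_fiber2 _ _ L L R lam lam (fun _ y => y + a.2)).
    by apply: measurable_funD => //; exact: measurable_cst.
  by move=> _; exact: lebesgue_measure_shift.
apply: (@measure_preserving_fiber1 _ _ L L R lam lam (fun _ y => y + a.1)).
  by apply: measurable_funD => //; exact: measurable_cst.
by move=> _; exact: lebesgue_measure_shift.
Qed.

Lemma lebesgue2_scale (a : R) (A : set (L * L)) : 0 < a -> measurable A ->
  lam2 ((fun p : L * L => (a * p.1, a * p.2) : L * L) @^-1` A) =
  ((a ^- 2)%:E * lam2 A)%E.
Proof.
move=> a0 mA.
have ma : measurable_fun setT (fun p : L * L => (a * p.1, a * p.2) : L * L).
  by apply: measurable_fun_pair; apply: measurable_funM => //;
    exact: measurable_cst.
pose nu := pushforward (mscale (NngNum (exprn_ge0 2 (ltW a0))) lam2)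
  (fun p : L * L => (a * p.1, a * p.2) : L * L).
have -> : lam2 A = nu A.
  apply: (product_measure_unique (m' := nu)) => // B C mB mC.
  rewrite /nu /= /pushforward /mscale /=.
  rewrite (_ : _ @^-1` _ = ((fun x : L => a * x : L) @^-1` B) `*`
      ((fun x : L => a * x : L) @^-1` C)) //.
  rewrite /lebesgue2 product_measure1E; last 2 first.
  - rewrite -[X in measurable X]setTI.
    by apply: measurable_funM => //; exact: measurable_cst.
  - rewrite -[X in measurable X]setTI.
    by apply: measurable_funM => //; exact: measurable_cst.
  transitivity ((a ^+ 2)%:E * (a^-1%:E * lam B * (a^-1%:E * lam C)))%E.
    by congr (_ * (_ * _))%E; exact: lebesgue_measure_scale.
  rewrite (muleACA (a^-1)%:E) !muleA -!EFinM -muleA.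
  by rewrite expr2 mulfK ?divff ?mul1e// gt_eqF.
rewrite /nu /pushforward /mscale /= muleA -EFinM mulVf ?mul1e//.
by rewrite sqrf_eq0 gt_eqF.
Qed.

(** The number pi, kept abstract: it cancels when a section of the body is
    compared with a section of the ball. *)
Definition disc_area : R := fine (lam2 [set q | (q.1 : R) ^+ 2 + q.2 ^+ 2 < 1]).

Lemma measurable_fun_normsq :
  measurable_fun setT (fun q : L * L => (q.1 : R) ^+ 2 + q.2 ^+ 2 : L).
Proof.
apply: measurable_funD; apply: measurable_funX.
  exact: measurable_fst.
exact: measurable_snd.
Qed.

Lemma measurable_disc r :
  measurable [set q : L * L | (q.1 : R) ^+ 2 + q.2 ^+ 2 < r].
Proof.
have := measurable_fun_normsq measurableT (measurable_itv `]-oo, r[).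
by rewrite setTI; congr measurable; apply/seteqP; split => x; rewrite /= in_itv.
Qed.

Lemma disc_areaE :
  lam2 [set q | (q.1 : R) ^+ 2 + q.2 ^+ 2 < 1] = disc_area%:E.
Proof.
rewrite fineK// ge0_fin_numE//.
apply: (@le_lt_trans _ _ (lam2 (`[-1, 1]%classic `*` `[-1, 1]%classic))).
  apply: le_measure; rewrite ?inE//.
  - exact: measurable_disc.
  - by apply: measurableX; exact: measurable_itv.
  - move=> [x y] /= h; rewrite !in_itv /=; split; apply/andP; nra.
exact: lebesgue2_square_lty.
Qed.

Lemma disc_area_ge0 : 0 <= disc_area.
Proof. exact/fine_ge0/measure_ge0. Qed.

Lemma lebesgue2_disc r :
  lam2 [set q | (q.1 : R) ^+ 2 + q.2 ^+ 2 < r] = (disc_area * Num.max r 0)%:E.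
Proof.
have [r0|r0] := lerP r 0.
  rewrite mulr0 (_ : [set _ | _] = set0) ?measure0//.
  apply/seteqP; split => // -[x y] /=; nra.
have s0 : 0 < (Num.sqrt r)^-1 by rewrite invr_gt0 sqrtr_gt0.
rewrite (_ : [set _ | _] = (fun p : L * L => ((Num.sqrt r)^-1 * p.1,
   (Num.sqrt r)^-1 * p.2) : L * L) @^-1` [set q | q.1 ^+ 2 + q.2 ^+ 2 < 1]).
  rewrite lebesgue2_scale//; last exact: measurable_disc.
  by rewrite disc_areaE -EFinM exprVn invrK sqr_sqrtr ?ltW// mulrC.
apply/seteqP; split => -[x y] /=;
  by rewrite !exprMn -mulrDr exprVn sqr_sqrtr ?ltW// ltr_pdivrMl// mulr1.
Qed.

(** The area of a disc is proportional to the square of its radius, so the squared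
    norm pushes the plane onto a uniform half-line.  It is enough to compare the
    two measures on the rays unbounded below, which generate the Borel sets and
    form a pi-system. *)
Lemma lebesgue2_radial (A : set L) : measurable A ->
  lam2 (fun q => A ((q.1 : R) ^+ 2 + q.2 ^+ 2)) =
  (disc_area%:E * lam (A `&` `[0%R, +oo[%classic))%E.
Proof.
have m0 : measurable (`[0%R, +oo[%classic : set L) by exact: measurable_itv.
pose mu := pushforward lam2 (fun q : L * L => (q.1 : R) ^+ 2 + q.2 ^+ 2 : L).
pose nu := mscale (NngNum disc_area_ge0) (mrestr lam m0).
have mn := measurable_fun_normsq.
have muE x : mu `]-oo, x[%classic = (disc_area * Num.max x 0)%:E.
  rewrite -lebesgue2_disc /mu /pushforward; apply: congr1.
  by apply/seteqP; split => q; rewrite /= in_itv.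
have nuE x : nu `]-oo, x[%classic = (disc_area * Num.max x 0)%:E.
  rewrite /nu /mscale /= /mrestr.
  rewrite (_ : _ `&` _ = `[0, x[%classic); last first.
    by apply/seteqP; split => y; rewrite /= !in_itv/= andbT;
      [case=> -> -> | case/andP].
  rewrite lebesgue_measure_itv /= lte_fin.
  by case: ltP => x0; rewrite ?sube0 ?mule0 ?mulr0// EFinM.
move=> mA; change (mu A = nu A).
apply: (@measure_unique _ _ L (@RGenInftyO.G R)
  (fun k => `]-oo, k%:R[%classic) _ _ _ _ mu nu) => //.
- exact: RGenInftyO.measurableE.
- move=> _ _ [x ->] [y ->]; exists (Num.min x y).
  apply/seteqP; split => z; rewrite /= !in_itv/= lt_min; first by case=> -> ->.
  by case/andP.
- by move=> i; exists i%:R.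
- apply/seteqP; split => // x _; exists (Num.truncn `|x|).+1 => //=.
  rewrite in_itv/=; apply: (le_lt_trans (ler_norm x)); exact: truncnS_gt.
- by move=> _ [x ->]; exact: etrans (muE x) (esym (nuE x)).
- by move=> k; rewrite [ltLHS](muE k%:R) ltry.
Qed.

End lebesgue_invariance.

(** * Rotations of space as products of shears *)

Section rotation.
Variable R : realType.
Local Notation L := (measurableTypeR R).
Local Notation lam := (@lebesgue_measure R).
Local Notation lam2 := (@lebesgue2 R).
Local Notation mp3 := (@measure_preserving _ (L * L * L)%type R (@lebesgue3 R)).

Lemma measure_preserving_shear3 (k : R) (a : R * R) :
  mp3 (fun y => (y.1, y.2 + k * (a.1 * y.1.1 + a.2 * y.1.2))).
Proof.
apply: (@measure_preserving_fiber2 _ _ (L * L)%type L R lam2 lam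
  (fun q z => z + k * (a.1 * q.1 + a.2 * q.2))).
  apply: measurable_funD => //; apply: measurable_funM => //.
  by apply: measurable_funD; apply: measurable_funM => //;
    apply: measurableT_comp => //.
by move=> q; exact: lebesgue_measure_shift.
Qed.

Lemma measure_preserving_shear12 (k : R) (a : R * R) :
  mp3 (fun y => ((y.1.1 + k * a.1 * y.2, y.1.2 + k * a.2 * y.2), y.2)).
Proof.
apply: (@measure_preserving_fiber1 _ _ (L * L)%type L R lam2 lam
  (fun z q => (q.1 + k * a.1 * z, q.2 + k * a.2 * z))).
  apply: measurable_fun_pair; apply: measurable_funD;
    [exact: measurableT_comp|exact: measurable_funM|
     exact: measurableT_comp|exact: measurable_funM].
by move=> z; exact: (lebesgue2_shift (k * a.1 * z, k * a.2 * z)).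
Qed.

(** The rotation in the plane spanned by b and the third axis that carries b to
    the third axis is a product of three shears, each of which preserves volume.
    With theta the angle of the rotation, S = |(b1, b2)|^2 and
    sin theta = sqrt S / beta, the usual coefficients tan (theta / 2) and
    - sin theta become rational in b and beta once the direction
    (b1, b2) / sqrt S is absorbed in them. *)
Lemma rotation_to_axis (b : R * R * R) :
  exists (beta : R) (f : R * R * R -> R * R * R),
  [/\ mp3 f, beta ^+ 2 = b.1.1 ^+ 2 + b.1.2 ^+ 2 + b.2 ^+ 2,
   forall y, beta * (f y).2 = b.1.1 * y.1.1 + b.1.2 * y.1.2 + b.2 * y.2 &
   forall y, (f y).1.1 ^+ 2 + (f y).1.2 ^+ 2 + (f y).2 ^+ 2 =
     y.1.1 ^+ 2 + y.1.2 ^+ 2 + y.2 ^+ 2].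
Proof.
case: b => [[b1 b2] b3] /=.
have [S0|S0] := eqVneq (b1 ^+ 2 + b2 ^+ 2) 0.
  have /andP[] : (b1 == 0) && (b2 == 0).
    by move/eqP: S0; rewrite paddr_eq0 ?sqr_ge0// !sqrf_eq0.
  move=> /eqP-> /eqP->; exists b3, id; split=> //.
  - by rewrite expr0n /= !add0r.
  - by move=> y; rewrite !mul0r !add0r.
have Sgt0 : 0 < b1 ^+ 2 + b2 ^+ 2.
  by rewrite lt_def S0 addr_ge0 ?sqr_ge0.
pose beta := Num.sqrt (b1 ^+ 2 + b2 ^+ 2 + b3 ^+ 2).
have betaE : beta ^+ 2 = b1 ^+ 2 + b2 ^+ 2 + b3 ^+ 2.
  by rewrite sqr_sqrtr// addr_ge0 ?sqr_ge0// ltW.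
have beta0 : beta != 0.
  by rewrite -sqrf_eq0 betaE gt_eqF// ltr_wpDr ?sqr_ge0.
(* k is tan (theta / 2) / sqrt S, that is (1 - cos theta) / (sin theta sqrt S) *)
pose k := (beta - b3) / (b1 ^+ 2 + b2 ^+ 2).
have kS : k * (b1 ^+ 2 + b2 ^+ 2) = beta - b3 by rewrite mulfVK.
have kB : k * (beta + b3) = 1.
  by rewrite /k mulrAC -subr_sqr betaE addrK divff.
pose f1 (y : R * R * R) := (y.1, y.2 + k * (b1 * y.1.1 + b2 * y.1.2)).
pose f2 (y : R * R * R) := ((y.1.1 + - beta^-1 * b1 * y.2,
  y.1.2 + - beta^-1 * b2 * y.2), y.2).
exists beta, (f1 \o f2 \o f1); split=> //.
- apply: measure_preserving_comp; first exact: (measure_preserving_shear3 k (b1, b2)).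
  apply: measure_preserving_comp; last exact: (measure_preserving_shear3 k (b1, b2)).
  exact: (measure_preserving_shear12 (- beta^-1) (b1, b2)).
- move=> [[y1 y2] y3] /=.
  set p := b1 * y1 + b2 * y2.
  transitivity (y3 * b3 + (k * (beta + b3)) * p +
     (beta - b3 - k * (b1 ^+ 2 + b2 ^+ 2)) * (y3 + k * p)).
    by rewrite /p; field.
  by rewrite kB kS; rewrite /p; ring.
- move=> [[y1 y2] y3] /=.
  set p := b1 * y1 + b2 * y2.
  set z1 := y3 + k * p.
  have -> : z1 + k * (b1 * (y1 + - beta^-1 * b1 * z1) + b2 * (y2 + - beta^-1 * b2 * z1)) =
    b3 * z1 / beta + k * p.
    transitivity (z1 - (k * (b1 ^+ 2 + b2 ^+ 2)) * z1 / beta + k * p).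
      by rewrite /p; field.
    by rewrite kS; field.
  transitivity (y1 ^+ 2 + y2 ^+ 2 + z1 ^+ 2 * (b1 ^+ 2 + b2 ^+ 2 + b3 ^+ 2) / beta ^+ 2
    + 2 * z1 * p * (k * (beta + b3) - 1) / beta - 2 * k * p * z1 + k ^+ 2 * p ^+ 2).
    by rewrite /p; field.
  by rewrite -betaE kB mulfK ?sqrf_eq0// /z1; ring.
Qed.

End rotation.

(** * Volumes of sets described by one coordinate and the norm *)

Section revolution.
Variable R : realType.
Local Notation L := (measurableTypeR R).
Local Notation lam := (@lebesgue_measure R).
Local Notation lam2 := (@lebesgue2 R).

(** After b is rotated to the third axis, the set is symmetric about that axis and
    its horizontal slices are preimages under the squared norm of the plane; so
    the pair (third coordinate, squared norm) becomes a pair of coordinates.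
    The constraint p.1 ^+ 2 <= p.2 records that the squared norm is at least the
    square of the third coordinate.  The same beta serves all P, which allows
    different bodies to be compared along one direction. *)
Lemma lebesgue3_revolution (b : R * R * R) :
  exists2 beta : R, beta ^+ 2 = b.1.1 ^+ 2 + b.1.2 ^+ 2 + b.2 ^+ 2 &
  forall P : set (L * L), measurable P ->
  lebesgue3 [set y : R * R * R | P (b.1.1 * y.1.1 + b.1.2 * y.1.2 + b.2 * y.2,
    y.1.1 ^+ 2 + y.1.2 ^+ 2 + y.2 ^+ 2)] =
  ((disc_area R)%:E *
   lam2 ([set p | (p.1 : R) ^+ 2 <= p.2 /\ P (beta * p.1 : R, p.2)])%R)%E.
Proof.
have [beta [f [[mf pf] betaE fb fn]]] := rotation_to_axis b.
exists beta => // P mP.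
pose E : set (L * L * L) := [set y | P (beta * y.2 : R, (y.1.1 : R) ^+ 2 + y.1.2 ^+ 2 + y.2 ^+ 2)].
have mE : measurable E.
  have mg : measurable_fun setT (fun y : L * L * L =>
    (beta * y.2 : R, (y.1.1 : R) ^+ 2 + y.1.2 ^+ 2 + y.2 ^+ 2) : L * L).
    apply: measurable_fun_pair; first exact: measurable_funM.
    apply: measurable_funD; last exact: measurable_funX.
    apply: measurable_funD; apply: measurable_funX; exact: measurableT_comp.
  by have := mg measurableT _ mP; rewrite setTI.
rewrite (_ : [set y | _] = f @^-1` E); last first.
  by apply/seteqP; split => y; rewrite /E /= fb fn.
rewrite pf//.
have mG : measurable [set p : L * L | (p.1 : R) ^+ 2 <= p.2 /\ P (beta * p.1 : R, p.2)].
  apply: measurableI.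
    by apply: measurable_set_ler => //; exact: measurable_funX.
  have mg : measurable_fun setT (fun y : L * L => (beta * y.1 : R, y.2) : L * L).
    by apply: measurable_fun_pair => //; exact: measurable_funM.
  by have := mg measurableT _ mP; rewrite setTI.
transitivity (\int[lam]_z lam2 (ysection E z))%E.
  exact: (product_measure_ysection lam2 lam mE).
set G := [set p : L * L | _] in mG *.
transitivity (\int[lam]_z ((disc_area R)%:E * lam (xsection G z)))%E; last first.
  rewrite ge0_integralZl//; last by rewrite lee_fin; exact: disc_area_ge0.
  exact: (measurable_fun_xsection lam mG).
apply: eq_integral => z _ /=.
pose A : set L := [set s : L | P (beta * z : R, s + z ^+ 2 : R)].
have mA : measurable A.
  have mg : measurable_fun setT (fun s : L => (beta * z : R, s + z ^+ 2 : R) : L * L).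
    by apply: measurable_fun_pair => //; apply: measurable_funD.
  by have := mg measurableT _ mP; rewrite setTI.
have /= := lebesgue2_radial mA.
rewrite (_ : (fun q => _) = ysection E z); last first.
  by apply/seteqP; split => q; rewrite /A /= /ysection /= inE.
move=> ->; congr (_ * _)%E.
rewrite -(proj2 (lebesgue_measure_shift (z ^+ 2)) (xsection G z)); last first.
  exact: measurable_xsection.
apply: congr1; apply/seteqP; split => s; rewrite /A /= /xsection/= inE /G/=.
  by rewrite in_itv/= andbT lerDr => -[].
by rewrite in_itv/= andbT lerDr => -[].
Qed.

End revolution.

(** * Slices of a section at fixed distance to the axis *)

Section slices.
Variable R : realType.
Local Notation L := (measurableTypeR R).
Local Notation lam := (@lebesgue_measure R).
Local Notation lam2 := (@lebesgue2 R).

(** The coordinates are w, along the axis, and the squared norm of the whole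
    point; p.2 - p.1 ^+ 2 is the squared distance to the axis.  The parameter e
    is the amount of shear, with e = 0 for the unit ball. *)
Definition sheared_profile (e : R) : set (R * R) :=
  [set p | (p.1 - e * (p.2 - p.1 ^+ 2)) ^+ 2 + (p.2 - p.1 ^+ 2) <= 1].

(** With (a, b) = (cos, sin) of the angle between the normal and the axis, the
    point z of the line at height t has coordinate b z + a t along the axis and
    a z - b t across it; tau is the squared distance to the axis. *)
Definition slice (e a b t tau : R) : set R :=
  [set z | (a * z - b * t) ^+ 2 <= tau /\
           (b * z + a * t - e * tau) ^+ 2 + tau <= 1].

Lemma measurable_sheared_profile e : measurable (sheared_profile e : set (L * L)).
Proof.
have m1 : measurable_fun setT (fun p : L * L => p.1 : R) by exact: measurable_fst.
have m2 : measurable_fun setT (fun p : L * L => p.2 : R) by exact: measurable_snd.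
have m3 : measurable_fun setT (fun p : L * L => (p.2 : R) - (p.1 : R) ^+ 2).
  by apply: measurable_funB => //; exact: measurable_funX.
apply: measurable_set_ler => //; apply: measurable_funD => //.
apply: measurable_funX; apply: measurable_funB => //.
exact: measurable_funM.
Qed.

Lemma measurable_slice e a b t tau : measurable (slice e a b t tau : set L).
Proof.
apply: measurableI; apply: measurable_set_ler => //.
  apply: measurable_funX; exact: measurable_funB.
apply: measurable_funD => //; apply: measurable_funX.
apply: measurable_funB => //; exact: measurable_funD.
Qed.

Lemma measurable_slices e a b t :
  measurable [set p : L * L | slice e a b t p.2 p.1].
Proof.
apply: measurableI; apply: measurable_set_ler => //.
  apply: measurable_funX; apply: measurable_funB => //.
  exact: measurable_funM.
apply: measurable_funD => //; apply: measurable_funX.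
apply: measurable_funB => //; first apply: measurable_funD => //;
  exact: measurable_funM.
Qed.

(** The shear (z, s) |-> (z, tau), with tau the squared distance to the axis,
    preserves area; then the order of integration is exchanged. *)
Lemma lebesgue2_slices e a b t : a ^+ 2 + b ^+ 2 = 1 ->
  lam2 [set p : R * R | p.1 ^+ 2 <= p.2 /\
     sheared_profile e (b * p.1 + t * a, p.2 + t ^+ 2)] =
  (\int[lam]_tau lam (slice e a b t tau))%E.
Proof.
move=> ab1.
pose F : set (L * L) := [set p | slice e a b t p.2 p.1].
have mF : measurable F by exact: measurable_slices.
transitivity ((lam \x lam)%E F); last first.
  rewrite product_measure_ysection//; apply: eq_integral => tau _.
  by apply: congr1; apply/seteqP; split => z; rewrite /ysection /F /= inE.
have mphi : measurable_fun setT (fun p : L * L => p.2 + (t ^+ 2 - (b * p.1 + t * a) ^+ 2) : L).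
  apply: measurable_funD => //; apply: measurable_funB => //.
  apply: measurable_funX; apply: measurable_funD => //; exact: measurable_funM.
have [_ /(_ F mF) <-] := measure_preserving_fiber2 lam (m2 := lam)
   (phi := fun z s => s + (t ^+ 2 - (b * z + t * a) ^+ 2)) mphi
   (fun z => lebesgue_measure_shift _).
apply: congr1; apply/seteqP; split => -[z s];
  rewrite /F /slice /sheared_profile /= => -[h1 h2]; split.
- have -> : (a * z - b * t) ^+ 2 = z ^+ 2 + t ^+ 2 - (b * z + t * a) ^+ 2
    + (a ^+ 2 + b ^+ 2 - 1) * (z ^+ 2 + t ^+ 2) by ring.
  by rewrite ab1 subrr mul0r addr0 -addrA lerD2r.
- by rewrite (mulrC a t) !(addrA s).
- move: h1; have -> : (a * z - b * t) ^+ 2 = z ^+ 2 + t ^+ 2 - (b * z + t * a) ^+ 2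
    + (a ^+ 2 + b ^+ 2 - 1) * (z ^+ 2 + t ^+ 2) by ring.
  by rewrite ab1 subrr mul0r addr0 -addrA lerD2r.
- by move: h2; rewrite (mulrC a t) !(addrA s).
Qed.

Lemma measurable_fun_slice e a b t :
  measurable_fun setT (fun tau : L => lam (slice e a b t tau)).
Proof.
pose F : set (L * L) := [set p | slice e a b t p.2 p.1].
have mF : measurable F by exact: measurable_slices.
have := measurable_fun_ysection lam mF.
rewrite (_ : lam \o ysection F = fun tau : L => lam (slice e a b t tau))//.
apply/funext => tau /=; apply: congr1.
by apply/seteqP; split => z; rewrite /ysection /F /= inE.
Qed.

(** For x = sqrt (1 - s) and y = sqrt (1 - s') this says that the square root of
    1 - s decreases with slope at least 1/2, the property that limits the shear
    to 1/2. *)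
Lemma norm_half_sqrB_le (x y : R) : 0 <= x <= 1 -> 0 <= y <= 1 ->
  `|(x ^+ 2 - y ^+ 2) / 2| <= `|x - y|.
Proof.
move=> /andP[x0 x1] /andP[y0 y1].
rewrite subr_sqr -mulrA normrM ler_piMr// ger0_norm ?divr_ge0 ?addr_ge0//.
by rewrite ler_pdivrMr// mul1r; lra.
Qed.

Lemma slice_out e a b t tau : ~~ (0 <= tau <= 1) -> slice e a b t tau = set0.
Proof.
move=> htau; apply/seteqP; split => // z [h1 h2]; case/negP: htau.
rewrite (le_trans _ h1) ?sqr_ge0//=; apply: le_trans h2.
by rewrite lerDr sqr_ge0.
Qed.

Lemma lebesgue_measure_preimage_addr (c : R) (A : set L) : measurable A ->
  lam [set z | A (z + c)] = lam A.
Proof. by move=> mA; exact: (proj2 (lebesgue_measure_shift c)). Qed.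

(** For the ball, the constraint across the axis is the stronger one below
    tau = a^2 and the constraint along the axis above it.  The condition on a or b
    says that the stronger constraint does bound z. *)
Variant slice_case (a b tau : R) : Prop :=
| SliceOut of ~~ (0 <= tau <= 1)
| SliceLow of 0 <= tau <= a ^+ 2 & a != 0
| SliceHigh of a ^+ 2 <= tau <= 1 & b != 0.

Lemma sliceP a b tau : a ^+ 2 + b ^+ 2 = 1 -> slice_case a b tau.
Proof.
move=> ab1; have [/andP[t0 t1]|] := boolP (0 <= tau <= 1); last exact: SliceOut.
have [ta|at_] := leP tau (a ^+ 2).
  have [a0|a0] := eqVneq a 0; last by apply: SliceLow; rewrite ?t0.
  apply: SliceHigh; first by rewrite a0 expr0n t0 t1.
  by apply: contra_eq_neq ab1 => ->; rewrite a0 !expr0n addr0 eq_sym oner_eq0.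
apply: SliceHigh; first by rewrite ltW.
apply: contraTneq at_ => b0; rewrite -leNgt.
by move: ab1; rewrite b0 expr0n addr0 => ->.
Qed.

Lemma slice_low a b tau : a ^+ 2 + b ^+ 2 = 1 -> 0 <= tau <= a ^+ 2 -> a != 0 ->
  slice 0 a b 0 tau = [set z | (a * z) ^+ 2 <= tau].
Proof.
move=> ab1 /andP[t0 ta] a0.
have a2 : 0 < a ^+ 2 by rewrite exprn_even_gt0.
rewrite /slice; apply/seteqP; split => z /=; rewrite !mulr0 mul0r !subr0 addr0; first by case.
move=> h; split => //; rewrite -lerBrDr -(ler_pM2l a2).
rewrite exprMn mulrCA -exprMn.
apply: (@le_trans _ _ (b ^+ 2 * tau)); first by rewrite ler_wpM2l ?sqr_ge0.
rewrite (_ : b ^+ 2 = 1 - a ^+ 2); last by rewrite -ab1 addrC addKr.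
by rewrite mulrBl mulrBr mul1r mulr1 lerD2r.
Qed.

Lemma slice_high a b tau : a ^+ 2 + b ^+ 2 = 1 -> a ^+ 2 <= tau <= 1 -> b != 0 ->
  slice 0 a b 0 tau = [set z | (b * z) ^+ 2 + tau <= 1].
Proof.
move=> ab1 /andP[ta t1] b0.
have b2 : 0 < b ^+ 2 by rewrite exprn_even_gt0.
rewrite /slice; apply/seteqP; split => z /=; rewrite !mulr0 mul0r !subr0 addr0; first by case.
move=> h; split => //; rewrite -(ler_pM2l b2).
rewrite exprMn mulrCA -exprMn.
apply: (@le_trans _ _ (a ^+ 2 * (1 - tau))).
  by rewrite ler_wpM2l ?sqr_ge0// lerBrDr.
rewrite (_ : b ^+ 2 = 1 - a ^+ 2); last by rewrite -ab1 addrC addKr.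
by rewrite mulrBl mulrBr mul1r mulr1 lerD2r.
Qed.

(** One of the two constraints already gives an interval of the length of the
    concentric slice, whatever the centres are. *)
Lemma slice_le e a b t tau : a ^+ 2 + b ^+ 2 = 1 ->
  (lam (slice e a b t tau) <= lam (slice 0 a b 0 tau))%E.
Proof.
move=> ab1; have m0 := measurable_slice 0 a b 0 tau.
have m1 := measurable_slice e a b t tau.
have [h|h a0|h b0] := sliceP tau ab1; first by rewrite !slice_out.
- rewrite -(lebesgue_measure_preimage_addr (- (b * t / a)) m0).
  apply: le_measure; rewrite ?inE//.
    by rewrite -[X in measurable X]setTI; apply: (proj1 (lebesgue_measure_shift _)).
  move=> z [+ _]; rewrite (slice_low ab1 h a0) /=.
  by rewrite mulrDr mulrN (mulrC a (_ / a)) divfK.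
- rewrite -(lebesgue_measure_preimage_addr ((a * t - e * tau) / b) m0).
  apply: le_measure; rewrite ?inE//.
    by rewrite -[X in measurable X]setTI; apply: (proj1 (lebesgue_measure_shift _)).
  move=> z [_]; rewrite (slice_high ab1 h b0) /=.
  by rewrite mulrDr (mulrC b (_ / b)) divfK// addrA.
Qed.

(** At this height the two intervals have the same centre and the same length for
    tau = a^2; for every other tau the shift (a^2 - tau) / 2 of the centre is too
    small to make the shorter interval leave the longer one. *)
Lemma slice_eq a b tau : a ^+ 2 + b ^+ 2 = 1 ->
  lam (slice 2^-1 a b (a ^+ 3 / 2) tau) = lam (slice 0 a b 0 tau).
Proof.
move=> ab1; have m0 := measurable_slice 0 a b 0 tau.
(* the line meets the axis at w = a^2 / 2, which is the point z = c of the line *)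
pose c := a ^+ 2 * b / 2.
have e1 z : a * z - b * (a ^+ 3 / 2) = a * (z - c) by rewrite /c; field.
have e2 z : b * z + a * (a ^+ 3 / 2) - 2^-1 * tau =
    b * (z - c) + (a ^+ 2 - tau) / 2.
  transitivity (b * (z - c) + (a ^+ 2 * (a ^+ 2 + b ^+ 2) - tau) / 2).
    by rewrite /c; field.
  by rewrite ab1 mulr1.
have nb : 0 <= `|b| <= 1.
  rewrite normr_ge0 /= -(@ler_pXn2r _ 2) ?nnegrE//.
  by rewrite expr1n real_normK ?num_real// -ab1 lerDr sqr_ge0.
have dE : 0 <= tau <= 1 -> `|(a ^+ 2 - tau) / 2| <= `|Num.sqrt (1 - tau) - `|b| |.
  move=> /andP[t0 t1].
  rewrite (_ : a ^+ 2 - tau = Num.sqrt (1 - tau) ^+ 2 - `|b| ^+ 2).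
    apply: norm_half_sqrB_le => //.
    by rewrite sqrtr_ge0 -[leRHS]sqrtr1 ler_wsqrtr// lerBlDr lerDl.
  by rewrite sqr_sqrtr ?subr_ge0// real_normK ?num_real// -ab1; ring.
have b2 : b ^+ 2 = 1 - a ^+ 2 by rewrite -ab1 addrC addKr.
have leb : `|b| = Num.sqrt (1 - a ^+ 2) by rewrite -b2 sqrtr_sqr.
have [h|h a0|h b0] := sliceP tau ab1; first by rewrite !slice_out.
- rewrite -(lebesgue_measure_preimage_addr (- c) m0) (slice_low ab1 h a0).
  apply: congr1; apply/seteqP; split => z; rewrite /slice /= e1 e2; first by case.
  move=> hz; split=> //; case/andP: h => t0 ta.
  have t1 : tau <= 1 by rewrite (le_trans ta)// -ab1 lerDl sqr_ge0.
  have rb : `|b| <= Num.sqrt (1 - tau) by rewrite leb ler_wsqrtr// lerB.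
  rewrite -lerBrDr -[leRHS]sqr_sqrtr ?subr_ge0//.
  rewrite -(real_normK (num_real (_ + _))) ler_pXn2r ?nnegrE ?sqrtr_ge0//.
  apply: le_trans (ler_normD _ _) _.
  have := dE; rewrite t0 t1 => /(_ isT).
  rewrite (ger0_norm (x := _ - _)) ?subr_ge0// => hd.
  rewrite -(subrK `|b| (Num.sqrt _)) addrC lerD// normrM ler_piMr//.
  rewrite -(@ler_pXn2r _ 2) ?nnegrE// expr1n real_normK ?num_real//.
  rewrite -(@ler_pM2l _ (a ^+ 2)) ?exprn_even_gt0// mulr1 -exprMn.
  exact: le_trans hz ta.
- rewrite -(lebesgue_measure_preimage_addr ((a ^+ 2 - tau) / 2 / b - c) m0).
  rewrite (slice_high ab1 h b0).
  have e3 z : b * (z + ((a ^+ 2 - tau) / 2 / b - c)) =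
      b * (z - c) + (a ^+ 2 - tau) / 2 by field.
  apply: congr1; apply/seteqP; split => z; rewrite /slice /= e1 e2 e3.
    by case.
  move=> hz; split=> //; case/andP: h => ta t1.
  have t0 : 0 <= tau by rewrite (le_trans _ ta)// sqr_ge0.
  have rb : Num.sqrt (1 - tau) <= `|b| by rewrite leb ler_wsqrtr// lerB.
  have := dE; rewrite t0 t1 => /(_ isT); rewrite distrC.
  rewrite (ger0_norm (x := _ - _)) ?subr_ge0// => hd.
  apply: le_trans ta; rewrite exprMn ler_piMr ?sqr_ge0//.
  rewrite -(real_normK (num_real (z - c))) expr_le1//.
  rewrite -(@ler_pM2l _ `|b|) ?normr_gt0// mulr1 -normrM.
  rewrite -(addrK ((a ^+ 2 - tau) / 2) (b * (z - c))).
  apply: le_trans (ler_normB _ _) _.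
  rewrite -(subrKC (Num.sqrt (1 - tau)) `|b|) lerD//.
  rewrite -(@ler_pXn2r _ 2) ?nnegrE ?sqrtr_ge0// real_normK ?num_real//.
  by rewrite sqr_sqrtr ?subr_ge0// lerBrDr.
Qed.

End slices.

(** * Sections of the sheared ball *)

Section sheared_ball_sections.
Variable R : realType.
Local Notation L := (measurableTypeR R).
Local Notation lam := (@lebesgue_measure R).
Local Notation lam2 := (@lebesgue2 R).

Definition sheared_ball (e : R) : set 'rV[R]_4 :=
  [set x : 'rV[R]_4 | sheared_profile e (x 0 0, dot x x)].

Lemma dotE n (x y : 'rV[R]_n) : dot x y = \sum_i x 0 i * y 0 i.
Proof. by rewrite /dot mxE; apply: eq_bigr => i _; rewrite mxE. Qed.

Lemma dot_ge0 n (x : 'rV[R]_n) : 0 <= dot x x.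
Proof. by rewrite dotE sumr_ge0// => i _; rewrite -expr2 sqr_ge0. Qed.

Lemma coord_sqr_le_dot n (x : 'rV[R]_n) i : x 0 i ^+ 2 <= dot x x.
Proof.
rewrite dotE (bigD1 i)//= -expr2 lerDl sumr_ge0// => j _.
by rewrite -expr2 sqr_ge0.
Qed.

Lemma dotDl n (x y z : 'rV[R]_n) : dot (x + y) z = dot x z + dot y z.
Proof. by rewrite /dot mulmxDl mxE. Qed.

Lemma dotZl n k (x z : 'rV[R]_n) : dot (k *: x) z = k * dot x z.
Proof. by rewrite /dot -scalemxAl mxE. Qed.

Lemma dotNl n (x z : 'rV[R]_n) : dot (- x) z = - dot x z.
Proof. by rewrite /dot mulNmx mxE. Qed.

Lemma dotC n (x y : 'rV[R]_n) : dot x y = dot y x.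
Proof. by rewrite !dotE; apply: eq_bigr => i _; rewrite mulrC. Qed.

Lemma sphere_dot n (u : 'rV[R]_n) : sphere u -> dot u u = 1.
Proof.
move=> /= u1; rewrite -[LHS]sqr_sqrtr ?dot_ge0//.
by rewrite -[Num.sqrt _]/(enorm u) u1 expr1n.
Qed.

Lemma sum_ord3 (F : 'I_3 -> R) : \sum_(i < 3) F i = F 0 + F 1 + F 2.
Proof.
rewrite !big_ord_recl big_ord0 addr0 addrA.
by congr (_ + F _ + F _); exact/val_inj.
Qed.

Lemma section_volumeE e (u : 'rV[R]_4) t : sphere u ->
  let B := orthonormal_frame u in
  section_volume (sheared_ball e) u t =
  lebesgue3 [set y : R * R * R | sheared_profile e
    (B 0 0 * y.1.1 + B 1 0 * y.1.2 + B 2 0 * y.2 + t * u 0 0,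
     y.1.1 ^+ 2 + y.1.2 ^+ 2 + y.2 ^+ 2 + t ^+ 2)].
Proof.
move=> u1 B; have [BB Bu] := orthonormal_frameP u1.
have uu := sphere_dot u1.
rewrite -/B in BB Bu.
have BBE i j : dot (row i B) (row j B) = (i == j)%:R.
  have := congr1 (fun M : 'M[R]_3 => M i j) BB; rewrite /= mxE [RHS]mxE => <-.
  by rewrite dotE; apply: eq_bigr => k _; rewrite !mxE.
have BuE i : dot (row i B) u = 0.
  have := congr1 (fun M : 'cV[R]_3 => M i 0) Bu; rewrite /= mxE [RHS]mxE => <-.
  by rewrite dotE; apply: eq_bigr => k _; rewrite !mxE.
rewrite /section_volume /hyperplane_volume; apply: congr1.
have dotp y : dot (hyperplane_param u t y) (hyperplane_param u t y) =
   y.1.1 ^+ 2 + y.1.2 ^+ 2 + y.2 ^+ 2 + t ^+ 2.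
  rewrite /hyperplane_param -/B.
  rewrite !(dotDl, dotZl) !(dotC _ (_ + _)) !(dotDl, dotZl) !BBE !BuE uu.
  by rewrite !(dotC u) !BuE /=; ring.
have coord y : hyperplane_param u t y 0 0 =
   B 0 0 * y.1.1 + B 1 0 * y.1.2 + B 2 0 * y.2 + t * u 0 0.
  by rewrite /hyperplane_param -/B !mxE !(mulrC _ (B _ _)).
apply/seteqP; split => y; rewrite /sheared_ball /= dotp coord; first by case.
move=> Ky; split=> //.
exists (y.1.1 *: row 0 B + y.1.2 *: row 1 B + y.2 *: row 2 B) => //=.
by rewrite !(dotDl, dotZl) !BuE !mulr0 !addr0.
Qed.

(** The frame together with u is an orthogonal matrix, so its columns have
    norm 1 as well. *)
Lemma frame_first_column (u : 'rV[R]_4) : sphere u ->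
  let B := orthonormal_frame u in
  B 0 0 ^+ 2 + B 1 0 ^+ 2 + B 2 0 ^+ 2 = 1 - u 0 0 ^+ 2.
Proof.
move=> u1 B; have [BB Bu] := orthonormal_frameP u1; rewrite -/B in BB Bu.
pose C : 'M[R]_(3 + 1, 4) := col_mx B u.
have CC : C *m C^T = 1%:M.
  rewrite /C tr_col_mx mul_col_row BB Bu.
  have -> : u *m B^T = 0 by rewrite -[LHS]trmxK trmx_mul trmxK Bu trmx0.
  rewrite -[X in block_mx _ _ _ X]/(u *m u^T) [u *m u^T]mx11_scalar.
  by rewrite -[(u *m u^T) 0 0]/(dot u u) (sphere_dot u1) -scalar_mx_block.
have /(congr1 (fun M : 'M[R]_4 => M 0 0)) := @mulmx1C _ 4 C C^T CC.
rewrite [LHS]mxE [RHS]mxE eqxx /=.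
rewrite (@big_split_ord _ _ _ 3 1) /= big_ord1 mxE col_mxEd.
under eq_bigr do rewrite mxE col_mxEu -expr2.
by rewrite sum_ord3 -expr2 => /(canRL (addrK _)).
Qed.

Lemma section_volume_slices (u : 'rV[R]_4) : sphere u ->
  exists2 b : R, u 0 0 ^+ 2 + b ^+ 2 = 1 &
  forall e t, section_volume (sheared_ball e) u t =
   ((disc_area R)%:E * \int[lam]_tau lam (slice e (u 0 0)%R b t tau))%E.
Proof.
move=> u1; set B := orthonormal_frame u.
have [b bE bP] := lebesgue3_revolution (B 0 0, B 1 0, B 2 0).
have ab1 : u 0 0 ^+ 2 + b ^+ 2 = 1.
  by rewrite bE /= (frame_first_column u1) subrKC.
exists b => // e t; rewrite section_volumeE//.
rewrite -lebesgue2_slices//.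
pose P : set (L * L) := [set p | sheared_profile e (p.1 + t * u 0 0 : R, p.2 + t ^+ 2 : R)].
rewrite -(bP P)//.
have mg : measurable_fun setT
    (fun p : L * L => (p.1 + t * u 0 0, p.2 + t ^+ 2) : L * L).
  by apply: measurable_fun_pair; exact: measurable_funD.
by have := mg measurableT _ (measurable_sheared_profile e); rewrite setTI.
Qed.

(** The volume of a central section of the ball is the same for every u, whence
    the constancy of the maximal section of the sheared ball. *)
Lemma section_volume_ball (u : 'rV[R]_4) : sphere u ->
  section_volume (sheared_ball 0) u 0 =
  lebesgue3 [set y : R * R * R | y.1.1 ^+ 2 + y.1.2 ^+ 2 + y.2 ^+ 2 <= 1].
Proof.
move=> u1; rewrite (section_volumeE 0 0 u1); apply: congr1.
apply/seteqP; split => y; rewrite /sheared_profile /= mul0r !addr0 expr0n /=;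
  by rewrite !mul0r !addr0 subr0 subrKC.
Qed.

Lemma maximal_section_sheared_ball (u : 'rV[R]_4) : sphere u ->
  maximal_section (sheared_ball 2^-1) u
   (lebesgue3 [set y : R * R * R | y.1.1 ^+ 2 + y.1.2 ^+ 2 + y.2 ^+ 2 <= 1]).
Proof.
move=> u1; rewrite -(section_volume_ball u1).
have [b ab1 volE] := section_volume_slices u1.
split.
  exists (u 0 0 ^+ 3 / 2); first exact: I.
  rewrite !volE; congr (_ * _)%E.
  by apply: eq_integral => tau _; exact: slice_eq.
move=> _ [t _ <-]; rewrite !volE lee_wpmul2l ?lee_fin ?disc_area_ge0//.
apply: ge0_le_integral => //.
- exact: measurable_fun_slice.
- exact: measurable_fun_slice.
- by move=> tau _; exact: slice_le.
Qed.

Lemma lebesgue3_ball_fin :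
  lebesgue3 [set y : R * R * R | y.1.1 ^+ 2 + y.1.2 ^+ 2 + y.2 ^+ 2 <= 1]
  \is a fin_num.
Proof.
pose I : set L := `[(-1 : R), 1]%classic.
have mI : measurable I by exact: measurable_itv.
rewrite ge0_fin_numE; last exact: (measure_ge0 (lam2 \x lam)%E).
apply: (@le_lt_trans _ _ ((lam2 \x lam)%E (I `*` I `*` I))).
  apply: (le_measure (lam2 \x lam)%E); rewrite ?inE.
  - apply: measurable_set_ler => //; apply: measurable_funD;
      last exact: measurable_funX.
    by apply: measurable_funD; apply: measurable_funX; exact: measurableT_comp.
  - by do 2 apply: measurableX => //.
  - move=> [[x y] z] /= h; rewrite /I /= !in_itv /=.
    by split; [split|]; apply/andP; split; nra.
have hI : (lam I < +oo)%E by exact: lebesgue_measure_segment_lty.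
have mII : measurable (I `*` I) by exact: measurableX.
rewrite [ltLHS](product_measure1E lam2 lam mII mI).
by rewrite lte_mul_pinfty// ge0_fin_numE// lebesgue2_square_lty.
Qed.

End sheared_ball_sections.

(** * The sheared ball as a convex body of revolution *)

Section sheared_ball_geometry.
Variable R : realType.

(** The squared distance to the axis is a convex function, so at the convex
    combination it falls short of the combination of the values by some dl >= 0.
    Convexity of the region v^2 + s <= 1 bounds the point with dl left out; the
    displacement dl / 2 caused by dl is absorbed by the growth of sqrt (1 - s)
    when s decreases by dl. *)
Lemma sheared_profile_convex (l w1 s1 w2 s2 dl : R) : 0 <= l <= 1 ->
  0 <= s1 -> 0 <= s2 -> 0 <= dl ->
  (w1 - s1 / 2) ^+ 2 + s1 <= 1 -> (w2 - s2 / 2) ^+ 2 + s2 <= 1 ->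
  let s := l * s1 + (1 - l) * s2 - dl in 0 <= s ->
  (l * w1 + (1 - l) * w2 - s / 2) ^+ 2 + s <= 1.
Proof.
move=> /andP[l0 l1] s10 s20 dl0 h1 h2 s s0.
pose P := l * s1 + (1 - l) * s2.
pose V := l * (w1 - s1 / 2) + (1 - l) * (w2 - s2 / 2).
have hV : V ^+ 2 + P <= 1.
  have : l * ((w1 - s1 / 2) ^+ 2 + s1) + (1 - l) * ((w2 - s2 / 2) ^+ 2 + s2) <= 1.
    rewrite -[leRHS](subrKC l); apply: lerD; rewrite ler_piMr//.
    by rewrite subr_ge0.
  apply: le_trans; rewrite -subr_ge0.
  rewrite [leRHS](_ : _ = l * (1 - l) * ((w1 - s1 / 2) - (w2 - s2 / 2)) ^+ 2).
    by rewrite mulr_ge0 ?sqr_ge0// mulr_ge0// subr_ge0.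
  by rewrite /V /P; ring.
have P0 : 0 <= P by rewrite addr_ge0// mulr_ge0// subr_ge0.
have P1 : P <= 1 by rewrite (le_trans _ hV)// lerDr sqr_ge0.
have sE : s = P - dl by [].
have sP : s <= P by rewrite sE gerBl.
have s1' : s <= 1 := le_trans sP P1.
have -> : l * w1 + (1 - l) * w2 - s / 2 = V + dl / 2 by rewrite sE /V /P; field.
pose p := Num.sqrt (1 - P); pose q := Num.sqrt (1 - s).
have p2 : p ^+ 2 = 1 - P by rewrite sqr_sqrtr ?subr_ge0.
have q2 : q ^+ 2 = 1 - s by rewrite sqr_sqrtr ?subr_ge0.
have p0 : 0 <= p := sqrtr_ge0 _.
have pq : p <= q by rewrite ler_wsqrtr// lerB.
have q0 := le_trans p0 pq.
have q1 : q <= 1 by rewrite -[leRHS]sqrtr1 ler_wsqrtr// gerBl.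
have hd : dl / 2 <= q - p.
  have := @norm_half_sqrB_le R q p; rewrite p0 q0 q1 (le_trans pq q1) => /(_ isT isT).
  rewrite p2 q2 (_ : 1 - s - (1 - P) = dl); last by rewrite sE; ring.
  by rewrite !ger0_norm ?subr_ge0// divr_ge0.
have hVp : `|V| <= p.
  by rewrite -(@ler_pXn2r _ 2) ?nnegrE// real_normK ?num_real// p2 lerBrDr.
rewrite -lerBrDr -q2 -(real_normK (num_real (_ + _))) ler_pXn2r ?nnegrE//.
apply: le_trans (ler_normD _ _) _.
by rewrite -(subrKC p q) lerD// ger0_norm// divr_ge0.
Qed.

Lemma sheared_ballE e (x : 'rV[R]_4) : sheared_ball e x <->
  (x 0 0 - e * (dot x x - x 0 0 ^+ 2)) ^+ 2 + (dot x x - x 0 0 ^+ 2) <= 1.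
Proof. by []. Qed.

Lemma convex_sheared_ball :
  convex_set (sheared_ball 2^-1 : set (convex_lmodType 'rV[R]_4)).
Proof.
move=> x y l; rewrite !inE => /sheared_ballE hx /sheared_ballE hy.
have k0 : 0 <= l%:num by [].
have k1 : l%:num <= 1 by [].
set k := l%:num in k0 k1.
pose z : 'rV[R]_4 := k *: (x : 'rV[R]_4) + (1 - k) *: (y : 'rV[R]_4).
change (sheared_ball 2^-1 z).
have zz : dot z z - z 0 0 ^+ 2 = k * (dot x x - x 0 0 ^+ 2) +
   (1 - k) * (dot y y - y 0 0 ^+ 2) -
   k * (1 - k) * (dot (x - y) (x - y) - (x - y) 0 0 ^+ 2).
  rewrite /z !(dotDl, dotZl, dotNl) !(dotC _ (_ + _)) !(dotDl, dotZl, dotNl).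
  by rewrite !mxE (dotC y x); ring.
have sz : 0 <= dot z z - z 0 0 ^+ 2 by rewrite subr_ge0 coord_sqr_le_dot.
have z0 : z 0 0 = k * x 0 0 + (1 - k) * y 0 0 by rewrite !mxE.
apply/sheared_ballE; rewrite zz in sz *; rewrite z0 (mulrC 2^-1).
apply: sheared_profile_convex sz; rewrite ?k0 ?k1 ?subr_ge0 ?coord_sqr_le_dot//.
- by rewrite !mulr_ge0 ?subr_ge0// coord_sqr_le_dot.
- by rewrite (mulrC _ 2^-1).
- by rewrite (mulrC _ 2^-1).
Qed.

Lemma continuous_sheared_ball_fun (e : R) : continuous (fun x : 'rV[R]_4 =>
  (x 0 0 - e * (dot x x - x 0 0 ^+ 2)) ^+ 2 + (dot x x - x 0 0 ^+ 2)).
Proof.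
have c0 (i : 'I_4) : continuous (fun x : 'rV[R]_4 => x 0 i).
  exact: coord_continuous.
have cd : continuous (fun x : 'rV[R]_4 => dot x x).
  rewrite (_ : (fun x => _) = (fun x : 'rV[R]_4 => \sum_i x 0 i * x 0 i)); last first.
    by apply/funext => x; exact: dotE.
  apply: continuous_big => //.
    by apply: add_continuous.
  by move=> i _ x; apply: continuousM; exact: c0.
have cB (f g : 'rV[R]_4 -> R) : continuous f -> continuous g ->
    continuous (fun x => f x - g x).
  by move=> cf cg x; exact: (cvgB (cf x) (cg x)).
have cX (f : 'rV[R]_4 -> R) : continuous f -> continuous (fun x => f x ^+ 2).
  by move=> cf x; exact: (cvgM (cf x) (cf x)).
have cs := cB _ _ cd (cX _ (c0 0)).
have ce : continuous (fun x : 'rV[R]_4 => e * (dot x x - x 0 0 ^+ 2)).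
  by move=> x; exact: (cvgM (cvg_cst e) (cs x)).
by move=> x; exact: (cvgD (cX _ (cB _ _ (c0 0) ce) x) (cs x)).
Qed.

Lemma compact_sheared_ball : compact (sheared_ball 2^-1 : set 'rV[R]_4).
Proof.
have box : compact [set v : 'rV[R]_4 | forall i, `[(-2 : R), 2]%classic (v ord0 i)].
  by apply: (@rV_compact _ _ (fun=> `[(-2 : R), 2]%classic)) => _;
    exact: segment_compact.
apply: (subclosed_compact _ box).
  apply: (@preimage_closed _ _ (fun x : 'rV[R]_4 =>
    (x 0 0 - 2^-1 * (dot x x - x 0 0 ^+ 2)) ^+ 2 + (dot x x - x 0 0 ^+ 2))
    [set r | r <= 1]); last exact: closed_le.
  by move=> x _; exact: continuous_sheared_ball_fun.
move=> x /sheared_ballE h i /=.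
have sx : 0 <= dot x x - x 0 0 ^+ 2 by rewrite subr_ge0 coord_sqr_le_dot.
move: h sx; set s := dot x x - _; set w := x 0 0 => h sx.
have s1 : s <= 1 by apply: le_trans h; rewrite lerDr sqr_ge0.
have /andP[v0 v1] : -1 <= w - 2^-1 * s <= 1.
  by apply/andP; split; nra.
have d4 : dot x x <= 4.
  rewrite -(subrK (w ^+ 2) (dot x x)) -/s.
  (* |w| <= 3/2 because |w - s / 2| <= 1 and 0 <= s <= 1 *)
  have : (w - 3 / 2) * (w + 3 / 2) <= 0 by nra.
  by lra.
have := le_trans (coord_sqr_le_dot x i) d4.
by rewrite in_itv/= => ?; apply/andP; split; nra.
Qed.

Lemma interior_sheared_ball : (sheared_ball (2^-1 : R))° !=set0.
Proof.
exists 0; rewrite /interior /= nbhsE /=.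
exists [set x : 'rV[R]_4 | (x 0 0 - 2^-1 * (dot x x - x 0 0 ^+ 2)) ^+ 2 +
   (dot x x - x 0 0 ^+ 2) < 1].
  split.
    apply: (@open_comp _ _ (fun x : 'rV[R]_4 =>
      (x 0 0 - 2^-1 * (dot x x - x 0 0 ^+ 2)) ^+ 2 + (dot x x - x 0 0 ^+ 2))
      [set r | r < 1]); last exact: open_lt.
    by move=> x _; exact: continuous_sheared_ball_fun.
  by rewrite /= /dot mul0mx !mxE expr0n /= subr0 mulr0 subr0 expr0n addr0.
by move=> x /ltW h; apply/sheared_ballE.
Qed.

Definition meridian (w v : R) : 'rV[R]_4 :=
  w *: delta_mx 0 0 + v *: delta_mx 0 1.

Lemma dot_meridian (p : 'rV[R]_4) w v :
  dot (meridian w v) p = w * p 0 0 + v * p 0 1.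
Proof.
have dd (i : 'I_4) : dot (delta_mx 0 i) p = p 0 i.
  rewrite dotE (bigD1 i)//= big1 ?addr0 ?mxE ?eqxx ?mul1r// => j ji.
  by rewrite mxE (negbTE ji) andbF mul0r.
by rewrite /meridian dotDl !dotZl !dd.
Qed.

Lemma sheared_ball_meridian w v :
  sheared_ball 2^-1 (meridian w v) <-> (w - 2^-1 * v ^+ 2) ^+ 2 + v ^+ 2 <= 1.
Proof.
have c0 : meridian w v 0 0 = w by rewrite !mxE /= mulr1 mulr0 addr0.
have c1 : meridian w v 0 1 = v by rewrite !mxE /= mulr1 mulr0 add0r.
rewrite sheared_ballE dot_meridian c0 c1 -!expr2.
by rewrite (addrAC (w ^+ 2)) subrr add0r.
Qed.

(** A ball is symmetric in the hyperplane through its centre orthogonal to the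
    axis.  The chord on the axis forces this hyperplane through the origin, and
    the chord at distance 3/5 has its midpoint at height 9/50. *)
Lemma sheared_ball_not_euclidean : ~ euclidean_ball (sheared_ball (2^-1 : R)).
Proof.
move=> [p [r [r0 KE]]].
have refl w v : sheared_ball 2^-1 (meridian w v) -> sheared_ball 2^-1 (meridian (2 * p 0 0 - w) v).
  rewrite KE /= /enorm.
  suff -> : dot (meridian (2 * p 0 0 - w) v - p) (meridian (2 * p 0 0 - w) v - p) =
    dot (meridian w v - p) (meridian w v - p) by [].
  have dB (x : 'rV[R]_4) : dot (x - p) (x - p) = dot x x - 2 * dot x p + dot p p.
    rewrite !(dotDl, dotNl) !(dotC _ (_ - _)) !(dotDl, dotNl) (dotC p x); ring.
  rewrite !dB !dot_meridian !mxE /=; ring.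
have /sheared_ball_meridian h1 : sheared_ball 2^-1 (meridian (2 * p 0 0 - 1) 0).
  by apply/refl/sheared_ball_meridian; lra.
have /sheared_ball_meridian h2 : sheared_ball 2^-1 (meridian (2 * p 0 0 - -1) 0).
  by apply/refl/sheared_ball_meridian; lra.
have p0 : p 0 0 = 0 by nra.
have /sheared_ball_meridian : sheared_ball 2^-1 (meridian (2 * p 0 0 - 49 / 50) (3 / 5)).
  by apply/refl/sheared_ball_meridian; lra.
by rewrite p0; lra.
Qed.

(** The height x 0 0 is the inner product with the fixed vector of the rotation,
    hence invariant, as is the norm. *)
Lemma body_of_revolution_sheared_ball (e : R) : body_of_revolution (sheared_ball e).
Proof.
exists 0, (delta_mx 0 0); split.
  by apply/eqP => /matrixP/(_ 0 0); rewrite !mxE !eqxx => /eqP; rewrite oner_eq0.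
have inv Q x : rotation_fixing (delta_mx 0 0 : 'rV[R]_4) Q ->
    dot (x *m Q) (x *m Q) = dot x x /\ (x *m Q) 0 0 = x 0 0.
  move=> [QQ _ vQ]; split.
    by rewrite /dot trmx_mul mulmxA -(mulmxA x) QQ mulmx1.
  have E (y : 'rV[R]_4) : y 0 0 = (y *m (delta_mx 0 0 : 'rV[R]_4)^T) 0 0.
    by rewrite trmx_delta -colE mxE.
  by rewrite [LHS]E -{1}vQ trmx_mul mulmxA -(mulmxA x) QQ mulmx1 -E.
move=> Q rQ; have rQT : rotation_fixing (delta_mx 0 0 : 'rV[R]_4) Q^T.
  case: rQ => QQ dQ vQ; split.
  - by rewrite trmxK; exact: mulmx1C.
  - by rewrite det_tr.
  - by rewrite -{1}vQ -mulmxA QQ mulmx1.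
apply/seteqP; split => [_ [x Kx <-]|x Kx].
  rewrite add0r subr0 /sheared_ball /=; have [-> ->] := inv Q x rQ; exact: Kx.
exists (x *m Q^T).
  by rewrite /sheared_ball /=; have [-> ->] := inv _ x rQT.
by rewrite subr0 add0r -mulmxA (mulmx1C _) ?mulmx1//; case: rQ.
Qed.

End sheared_ball_geometry.

Theorem theorem1 (R : realType) :
  exists K : set 'rV[R]_4,
    [/\ convex_body K, body_of_revolution K,
        (exists c : R, forall u, sphere u -> maximal_section K u c%:E)
      & ~ euclidean_ball K].
Proof.
exists (sheared_ball 2^-1); split.
- split; [exact: compact_sheared_ball|exact: convex_sheared_ball|exact: interior_sheared_ball|].
  by apply/sheared_ballE; rewrite /dot mul0mx !mxE expr0n /= subr0 mulr0 subr0 expr0n addr0 ler01.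
- exact: body_of_revolution_sheared_ball.
- exists (fine (lebesgue3 [set y : R * R * R |
    y.1.1 ^+ 2 + y.1.2 ^+ 2 + y.2 ^+ 2 <= 1])) => u u1.
  by rewrite (fineK (lebesgue3_ball_fin R)); exact: maximal_section_sheared_ball.
- exact: sheared_ball_not_euclidean.
Qed.
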